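(* For integers $a,b$ with $0<a<b$, the Mordell-Weil rank of $E'_{a,b}(\mathbb{Q})$, where $E'_{a,b}$ is the elliptic curve $y^{2} = x^{3} - a^{2}x + b^{6}$, is at least $3$.
   Context: For an elliptic curve $E$ over $\mathbb{Q}$, the Mordell-Weil rank is the rank $r$ in $E(\mathbb{Q}) \cong \mathbb{Z}^r \oplus E(\mathbb{Q})_{\mathrm{tors}}$. *)

(* Defs.v *)
From mathcomp Require Import all_boot all_order all_algebra.
Set Implicit Arguments. Unset Strict Implicit. Unset Printing Implicit Defensive.
Import Order.TTheory GRing.Theory Num.Theory.
Local Open Scope ring_scope.

Inductive ecpt : Type := EInf | EPt of rat & rat.

Definition oncurve (A B : rat) (p : ecpt) : bool :=
  match p with
  | EInf => true
  | EPt x y => y ^+ 2 == x ^+ 3 + A * x + B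
  end.

Definition ecneg (p : ecpt) : ecpt :=
  match p with EInf => EInf | EPt x y => EPt x (- y) end.

Definition ecadd (A : rat) (p q : ecpt) : ecpt :=
  match p, q with
  | EInf, _ => q
  | _, EInf => p
  | EPt x1 y1, EPt x2 y2 =>
      if (x1 == x2) && (y1 == - y2) then EInf
      else
        let l := if x1 == x2 then (3%:R * x1 ^+ 2 + A) / (2%:R * y1)
                 else (y2 - y1) / (x2 - x1) in
        let x3 := l ^+ 2 - x1 - x2 in
        EPt x3 (l * (x1 - x3) - y1)
  end.

Definition ecmuln (A : rat) (n : nat) (p : ecpt) : ecpt :=
  iter n (ecadd A p) EInf.

Definition ecmulz (A : rat) (n : int) (p : ecpt) : ecpt :=
  match n with
  | Posz m => ecmuln A m p
  | Negz m => ecneg (ecmuln A m.+1 p)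
  end.

Definition ec_nonsingular (A B : rat) : bool :=
  4%:R * A ^+ 3 + 27%:R * B ^+ 2 != 0.

(* The Mordell-Weil rank of E(Q) is at least r: there are r rational points
   which are linearly independent over Z (no nontrivial integer relation
   sum c_i P_i = O), i.e. whose images in E(Q)/E(Q)_tors are independent. *)
Definition mw_rank_ge (A B : rat) (r : nat) : Prop :=
  exists P : 'I_r -> ecpt,
    (forall i, oncurve A B (P i)) /\
    (forall c : 'I_r -> int,
        \big[ecadd A/EInf]_(i < r) ecmulz A (c i) (P i) = EInf ->
        forall i, c i = 0).

(* Main.v *)
(** Put t = a / b^2, P = (0, b^3), Q = (a, b^3), R = (- b^2, a b), and suppose
    x P + y Q + z R = O with integers x, y, z.

    For a prime p, the points reducing to infinity modulo p on a p-integral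
    model form a subgroup of E(Q).  Since 0 < t < 1, some p divides the
    denominator of t; on the model with abscissa X / a the points P and R reduce
    to the same 2-torsion point and Q to another one, so y and x + z are even.

    If x and z were odd, P - R would be twice a rational point.  The slope of
    the tangent at that point gives a rational v with
      4 t v (v^2 - 1) = v^4 - 4 v^3 - 6 v^2 - 4 v + 1,
    and this forces 8 to divide the denominator of t.  But then 2P, 2Q and 4R are
    2-adically closer to infinity than 2R, so z is even, a contradiction.

    Hence x, y, z are all even.  The condition a < b excludes rational 2-torsion,
    so the relation can be halved, and infinite descent gives x = y = z = 0. *)

From HB Require Import structures.
Require Import Defs.
From mathcomp Require Import all_boot all_order all_algebra.
From mathcomp Require Import ring lra zify.
Set Implicit Arguments. Unset Strict Implicit. Unset Printing Implicit Defensive.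
Import Order.TTheory GRing.Theory Num.Theory.
Local Open Scope ring_scope.

(** Transports decidable equality and choice to points, on which the group instance rests. *)
Definition ecpt_code (p : ecpt) : option (rat * rat) :=
  if p is EPt x y then Some (x, y) else None.
Definition ecpt_decode (c : option (rat * rat)) : ecpt :=
  if c is Some (x, y) then EPt x y else EInf.
Lemma ecpt_codeK : cancel ecpt_code ecpt_decode. Proof. by case. Qed.
HB.instance Definition _ := Choice.copy ecpt (can_type ecpt_codeK).

(** * The group law *)

Section GenericIdentities.
Variables (F : numFieldType) (A x1 y1 x2 y2 : F).

(** Associativity when the lines pq and qr differ and both outer sums are secants; ([x12], [y12]) is
    p + q and ([x23], [y23]) is q + r. *)
Lemma associativity_identity x3 y3 l m n k x12 y12 x23 y23 :
  y1 - y2 = l * (x1 - x2) -> y2 - y3 = m * (x2 - x3) ->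
  l * (y1 + y2) = x1 ^+ 2 + x1 * x2 + x2 ^+ 2 + A ->
  m * (y2 + y3) = x2 ^+ 2 + x2 * x3 + x3 ^+ 2 + A ->
  l != m -> x12 != x3 -> x1 != x23 ->
  x12 = l ^+ 2 - x1 - x2 -> y12 = l * (x1 - x12) - y1 ->
  x23 = m ^+ 2 - x2 - x3 -> y23 = m * (x2 - x23) - y2 ->
  n = (y12 - y3) / (x12 - x3) -> k = (y1 - y23) / (x1 - x23) ->
  let X := n ^+ 2 - x12 - x3 in let X' := k ^+ 2 - x1 - x23 in
  X = X' /\ n * (x12 - X) - y12 = k * (x1 - X') - y1.
Proof.
move=> s1 s3 t1 t3; rewrite -subr_eq0 => d; rewrite -subr_eq0 => h1.
rewrite -subr_eq0 => h2 e12 f12 e23 f23.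
have e1 : y1 = y2 + l * (x1 - x2) by rewrite -s1; ring.
have e3 : y3 = y2 - m * (x2 - x3) by rewrite -s3; ring.
(* The two slopes determine the ordinates, so that the identity to be checked
   is one between rational functions of x1, x2, x3, l and m. *)
have e2 : y2 = (x1 ^+ 2 - x3 ^+ 2 + x2 * (x1 - x3) - l ^+ 2 * (x1 - x2) +
    m ^+ 2 * (x3 - x2)) / (2 * (l - m)).
  suff <- : 2 * (l - m) * y2 = x1 ^+ 2 - x3 ^+ 2 + x2 * (x1 - x3) -
    l ^+ 2 * (x1 - x2) + m ^+ 2 * (x3 - x2) by field.
  have -> : x1 ^+ 2 - x3 ^+ 2 + x2 * (x1 - x3) =
    (x1 ^+ 2 + x1 * x2 + x2 ^+ 2 + A) - (x2 ^+ 2 + x2 * x3 + x3 ^+ 2 + A) by ring.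
  by rewrite -t1 -t3 e1 e3; ring.
move: h1 h2; rewrite f12 f23 e1 e3 e2 e12 e23 => h1 h2 -> ->.
by split; field; rewrite d h1 h2.
Qed.

(** Translation by a 2-torsion point T = ([x2], 0) preserves doubles: 2(p + T) = 2p. *)
Lemma translate_double_identity (l := y1 / (x1 - x2)) (m := (3 * x1 ^+ 2 + A) / (2 * y1))
    (x3 := l ^+ 2 - x1 - x2) (y3 := l * (x1 - x3) - y1)
    (n := (3 * x3 ^+ 2 + A) / (2 * y3)) :
  x1 != x2 -> y1 != 0 -> y3 != 0 ->
  l * y1 = x1 ^+ 2 + x1 * x2 + x2 ^+ 2 + A ->
  let X := n ^+ 2 - x3 - x3 in let X' := m ^+ 2 - x1 - x1 in
  X = X' /\ n * (x3 - X) - y3 = m * (x1 - X') - y1.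
Proof.
rewrite -subr_eq0 => d hy1 hy3 hA.
have ey : y1 = l * (x1 - x2) by rewrite /l; field.
have l0 : l != 0 by apply: contraNneq hy1 => l0; rewrite ey l0 mul0r.
have eA : A = l ^+ 2 * (x1 - x2) - x1 ^+ 2 - x1 * x2 - x2 ^+ 2.
  by rewrite expr2 -mulrA -ey hA; ring.
move: hy3; rewrite /n /m /y3 /x3; move: (l) l0 ey eA => {hA} k k0 -> -> hy3.
by split; field; rewrite d k0 hy3.
Qed.

(** This is (p - q) + (p + q) = 2p; [l] and [m] are the slopes from p to -q and to q. *)
Lemma sum_difference_identity (l := (y1 + y2) / (x1 - x2)) (m := (y1 - y2) / (x1 - x2))
    (k := (3 * x1 ^+ 2 + A) / (2 * y1))
    (x3 := l ^+ 2 - x1 - x2) (y3 := l * (x1 - x3) - y1)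
    (x4 := m ^+ 2 - x1 - x2) (y4 := m * (x1 - x4) - y1)
    (n := (y3 - y4) / (x3 - x4)) :
  x1 != x2 -> y1 != 0 -> y2 != 0 ->
  m * (y1 + y2) = x1 ^+ 2 + x1 * x2 + x2 ^+ 2 + A ->
  x3 != x4 /\
  let X := n ^+ 2 - x3 - x4 in let X' := k ^+ 2 - x1 - x1 in
  X = X' /\ n * (x3 - X) - y3 = k * (x1 - X') - y1.
Proof.
rewrite -subr_eq0 => d hy1 hy2 hA.
have eA : A = m * (y1 + y2) - x1 ^+ 2 - x1 * x2 - x2 ^+ 2 by rewrite hA; ring.
have d34 : x3 - x4 = 4 * y1 * y2 / (x1 - x2) ^+ 2 by rewrite /x3 /x4 /l /m; field.
have nz : x3 - x4 != 0.
  by rewrite d34 !mulf_neq0 ?invr_neq0 ?expf_neq0 ?pnatr_eq0.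
split; first by rewrite -subr_eq0.
rewrite /n d34 /k eA /y3 /y4 /x3 /x4 /l /m.
by split; field; rewrite d hy1 hy2.
Qed.

End GenericIdentities.

(** * The axioms of the addition law *)

Section Slopes.
Variables A B : rat.

(* One condition for chords and tangents alike: the first equation determines l
   when x1 != x2, the second one when y1 != - y2. *)
Definition slope (x1 y1 x2 y2 l : rat) : Prop :=
  y1 - y2 = l * (x1 - x2) /\
  l * (y1 + y2) = x1 ^+ 2 + x1 * x2 + x2 ^+ 2 + A.

Definition chord (x1 y1 x2 l : rat) : ecpt :=
  let x3 := l ^+ 2 - x1 - x2 in EPt x3 (l * (x1 - x3) - y1).

Lemma oncurveP x y : reflect (y ^+ 2 = x ^+ 3 + A * x + B) (oncurve A B (EPt x y)).
Proof. exact: eqP. Qed.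

Lemma oncurve_same_x x y1 y2 :
  oncurve A B (EPt x y1) -> oncurve A B (EPt x y2) -> y1 = y2 \/ y1 = - y2.
Proof.
move=> /oncurveP h1 /oncurveP h2.
have : y1 ^+ 2 == y2 ^+ 2 by rewrite h1 h2.
by rewrite eqf_sqr => /orP[]/eqP; [left | right].
Qed.

Lemma slope_uniq x1 y1 x2 y2 l m :
  ~ (x1 = x2 /\ y1 = - y2) -> slope x1 y1 x2 y2 l -> slope x1 y1 x2 y2 m -> l = m.
Proof.
move=> nopp [l1 l2] [m1 m2]; have [ex|nx] := eqVneq x1 x2; last first.
  by apply: (mulIf (x := x1 - x2)); rewrite ?subr_eq0// -l1.
have [ey|ny] := eqVneq (y1 + y2) 0.
  by case: nopp; split=> //; apply/eqP; rewrite -addr_eq0 ey.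
by apply: (mulIf ny); rewrite l2.
Qed.

Variant ecadd_spec (x1 y1 x2 y2 : rat) : ecpt -> Prop :=
  | EcaddOpp of x1 = x2 & y1 = - y2 : ecadd_spec x1 y1 x2 y2 EInf
  | EcaddChord l of slope x1 y1 x2 y2 l & ~ (x1 = x2 /\ y1 = - y2) :
      ecadd_spec x1 y1 x2 y2 (chord x1 y1 x2 l).

Lemma ecaddP x1 y1 x2 y2 :
  oncurve A B (EPt x1 y1) -> oncurve A B (EPt x2 y2) ->
  ecadd_spec x1 y1 x2 y2 (ecadd A (EPt x1 y1) (EPt x2 y2)).
Proof.
move=> h1 h2 /=.
case: ifP => [/andP[/eqP ex /eqP ey]|/negbT nopp]; first exact: EcaddOpp.
have nopp' : ~ (x1 = x2 /\ y1 = - y2).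
  by case=> ex ey; move: nopp; rewrite ex ey !eqxx.
apply: EcaddChord => //; case: eqVneq => [ex|nx].
- move: h2 nopp'; rewrite -ex => h2 nopp'.
  case: (oncurve_same_x h1 h2) => // ey; last by case: nopp'.
  rewrite -ey in nopp' *.
  have ny : y1 != 0 by apply/eqP=> y0; apply: nopp'; rewrite y0 oppr0.
  by split; [ring | field].
- have nx' : x2 - x1 != 0 by rewrite subr_eq0 eq_sym.
  split; first by field.
  apply: (mulfI nx'); move/oncurveP: h1 => h1; move/oncurveP: h2 => h2.
  have -> : (x2 - x1) * ((y2 - y1) / (x2 - x1) * (y1 + y2)) = y2 ^+ 2 - y1 ^+ 2 by field.
  by rewrite h1 h2; ring.
Qed.

Lemma ecadd_chord x1 y1 x2 y2 l :
  oncurve A B (EPt x1 y1) -> oncurve A B (EPt x2 y2) ->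
  slope x1 y1 x2 y2 l -> ~ (x1 = x2 /\ y1 = - y2) ->
  ecadd A (EPt x1 y1) (EPt x2 y2) = chord x1 y1 x2 l.
Proof.
move=> h1 h2 sl nopp; case: (ecaddP h1 h2) => [ex ey|m sm _]; first by case: nopp.
by rewrite (slope_uniq nopp sl sm).
Qed.

(** Vieta: substituting the line leaves a monic cubic with roots [x1], [x2] (double for a tangent)
    and root sum [l ^+ 2]. *)
Lemma line_factor x1 y1 x2 y2 l x :
  oncurve A B (EPt x1 y1) -> slope x1 y1 x2 y2 l ->
  x ^+ 3 + A * x + B - (y1 + l * (x - x1)) ^+ 2 =
  (x - x1) * (x - x2) * (x - (l ^+ 2 - x1 - x2)).
Proof.
move=> /oncurveP h1 [s1 s2].
have eA : A = l * (y1 + y2) - (x1 ^+ 2 + x1 * x2 + x2 ^+ 2) by rewrite s2; ring.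
have eB : B = y1 ^+ 2 - x1 ^+ 3 - A * x1 by rewrite h1; ring.
have ey : y2 = y1 - l * (x1 - x2) by rewrite -s1; ring.
by rewrite eB eA ey; ring.
Qed.

Lemma oncurve_chord x1 y1 x2 y2 l :
  oncurve A B (EPt x1 y1) -> slope x1 y1 x2 y2 l -> oncurve A B (chord x1 y1 x2 l).
Proof.
move=> h1 sl; apply/eqP; have := line_factor (l ^+ 2 - x1 - x2) h1 sl.
rewrite subrr mulr0 => /eqP; rewrite subr_eq0 => /eqP ->; ring.
Qed.

Lemma oncurve_neg p : oncurve A B (ecneg p) = oncurve A B p.
Proof. by case: p => //= x y; rewrite sqrrN. Qed.

Lemma oncurve_add p q : oncurve A B p -> oncurve A B q -> oncurve A B (ecadd A p q).
Proof.
case: p q => [|x1 y1] [|x2 y2] // h1 h2.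
by case: (ecaddP h1 h2) => // l sl _; apply: oncurve_chord h1 sl.
Qed.

Lemma slopeC x1 y1 x2 y2 l : slope x1 y1 x2 y2 l -> slope x2 y2 x1 y1 l.
Proof.
case=> s1 s2; split; first by rewrite -opprB s1; ring.
by rewrite addrC s2; ring.
Qed.

Lemma slopeN x1 y1 x2 y2 l :
  slope x1 y1 x2 y2 l -> slope x1 (- y1) x2 (- y2) (- l).
Proof.
case=> s1 s2; split; last by rewrite -s2; ring.
by rewrite mulNr -s1; ring.
Qed.

Lemma chordC x1 y1 x2 y2 l :
  slope x1 y1 x2 y2 l -> chord x1 y1 x2 l = chord x2 y2 x1 l.
Proof.
case=> s1 s2; rewrite /chord; have -> : y1 = y2 + l * (x1 - x2) by rewrite -s1; ring.
by congr EPt; ring.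
Qed.

Lemma ecaddC p q : oncurve A B p -> oncurve A B q -> ecadd A p q = ecadd A q p.
Proof.
case: p q => [|x1 y1] [|x2 y2] // h1 h2.
case: (ecaddP h1 h2) => [-> ->|l sl nopp]; first by rewrite /= opprK !eqxx.
rewrite (ecadd_chord h2 h1 (slopeC sl)); first exact: chordC.
by case=> ex ey; apply: nopp; rewrite ex ey opprK.
Qed.

Lemma ecaddN p : oncurve A B p -> ecadd A (ecneg p) p = EInf.
Proof. by case: p => //= x y _; rewrite !eqxx. Qed.

Lemma ecnegK : involutive ecneg.
Proof. by case=> //= x y; rewrite opprK. Qed.

Lemma ecadd0 p : ecadd A p EInf = p.
Proof. by case: p. Qed.

Lemma ecneg_add p q : oncurve A B p -> oncurve A B q ->
  ecneg (ecadd A p q) = ecadd A (ecneg p) (ecneg q).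
Proof.
case: p q => [|x1 y1] [|x2 y2] // h1 h2.
case: (ecaddP h1 h2) => [-> ->|l sl nopp]; first by rewrite /= !eqxx.
have noppN : ~ (x1 = x2 /\ - y1 = - - y2).
  by case=> ex /oppr_inj ey; apply: nopp.
have h1' : oncurve A B (EPt x1 (- y1)) by rewrite (oncurve_neg (EPt x1 y1)).
have h2' : oncurve A B (EPt x2 (- y2)) by rewrite (oncurve_neg (EPt x2 y2)).
rewrite [RHS](ecadd_chord h1' h2' (slopeN sl) noppN).
by rewrite /chord /= sqrrN; congr EPt; ring.
Qed.

(** The reflected line passes through -p, -q and p + q, with slope [- l]; this gives the
    cancellation -p + (p + q) = q. *)
Lemma slope_third x1 y1 x2 y2 l : slope x1 y1 x2 y2 l ->
  let x3 := l ^+ 2 - x1 - x2 in slope x1 (- y1) x3 (l * (x1 - x3) - y1) (- l).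
Proof.
case=> s1 s2 x3; rewrite /x3; split; first by ring.
have ey : y2 = y1 - l * (x1 - x2) by rewrite -s1; ring.
have -> : A = l * (y1 + y2) - (x1 ^+ 2 + x1 * x2 + x2 ^+ 2) by rewrite s2; ring.
by rewrite ey; ring.
Qed.

Lemma chord_third x1 y1 x2 y2 l : slope x1 y1 x2 y2 l ->
  chord x1 (- y1) (l ^+ 2 - x1 - x2) (- l) = EPt x2 y2.
Proof.
case=> s1 s2; have -> : y2 = y1 - l * (x1 - x2) by rewrite -s1; ring.
by rewrite /chord; congr EPt; ring.
Qed.

Hypothesis ns : ec_nonsingular A B.

Lemma nonsingular_root x : oncurve A B (EPt x 0) -> 3%:R * x ^+ 2 + A <> 0.
Proof.
move=> /oncurveP h hA; move/negP: ns; apply; apply/eqP.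
have eA : A = - (3%:R * x ^+ 2) by lra.
have eB : B = - x ^+ 3 - A * x by move: h; rewrite expr0n /=; lra.
by rewrite eB eA; ring.
Qed.

(** Cancellation comes before associativity, whose degenerate cases reduce to it. *)
Lemma ecaddKr p q : oncurve A B p -> oncurve A B q ->
  ecadd A (ecneg p) (ecadd A p q) = q.
Proof.
case: p q => [|x1 y1] [|x2 y2] // h1 h2; first exact: ecaddN.
case: (ecaddP h1 h2) => [-> ->|l sl nopp]; first by rewrite /= opprK.
have h1' : oncurve A B (EPt x1 (- y1)) by rewrite (oncurve_neg (EPt x1 y1)).
rewrite (ecadd_chord h1' (oncurve_chord h1 sl) (slope_third sl)).
  exact: chord_third sl.
(* If p + q = p then p is fixed by negation and the tangent at p is a chord
   of finite slope, which forces the partial derivatives at p to vanish. *)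
case=> ex /oppr_inj ey; have [_] := slope_third sl.
move: ey; rewrite -ex subrr mulr0 sub0r => ey h.
have y0 : y1 = 0 by lra.
rewrite y0 in h1 h; apply: (nonsingular_root h1); lra.
Qed.

Lemma ecaddK p q : oncurve A B p -> oncurve A B q ->
  ecadd A (ecadd A p q) (ecneg q) = p.
Proof.
move=> hp hq; have hq' : oncurve A B (ecneg q) by rewrite oncurve_neg.
by rewrite (ecaddC _ hq') ?oncurve_add// (ecaddC hp hq) ecaddKr.
Qed.

Lemma on_chord x1 y1 x2 y2 x3 y3 l :
  oncurve A B (EPt x1 y1) -> oncurve A B (EPt x3 y3) ->
  slope x1 y1 x2 y2 l -> y3 = y1 + l * (x3 - x1) ->
  [\/ EPt x3 y3 = EPt x1 y1, EPt x3 y3 = EPt x2 y2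
    | EPt x3 y3 = ecneg (chord x1 y1 x2 l)].
Proof.
move=> h1 /oncurveP h3 sl ey; have := line_factor x3 h1 sl.
rewrite -h3 -ey subrr => /esym/eqP; rewrite !mulf_eq0 !subr_eq0 => /orP[/orP[]|]/eqP ex.
- by apply: Or31; rewrite ey ex; congr EPt; ring.
- apply: Or32; case: sl => s1 _; rewrite ey ex; congr EPt.
  by rewrite -opprB mulrN -s1; ring.
- by apply: Or33; rewrite /chord /= -ex ey; congr EPt; ring.
Qed.

Lemma ecadd_secant x1 y1 x2 y2 (l := (y1 - y2) / (x1 - x2)) :
  oncurve A B (EPt x1 y1) -> oncurve A B (EPt x2 y2) -> x1 != x2 ->
  ecadd A (EPt x1 y1) (EPt x2 y2) = chord x1 y1 x2 l.
Proof.
move=> h1 h2 nx; case: (ecaddP h1 h2) => [ex|m [s1 _] _]; first by rewrite ex eqxx in nx.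
by rewrite /l s1 mulfK // subr_eq0.
Qed.

Lemma ecadd_tangent x y (l := (3%:R * x ^+ 2 + A) / (2%:R * y)) : y != 0 ->
  ecadd A (EPt x y) (EPt x y) = chord x y x l.
Proof.
by move=> ny; rewrite /= eqxx -addr_eq0 -mulr2n mulrn_eq0 (negPf ny).
Qed.

(** Serves the associativity cases where an outer sum is a doubling: for r = p + q it yields p + (q
    + r) = 2r. *)
Lemma ecadd_sum_difference p q : oncurve A B p -> oncurve A B q ->
  ecadd A (ecadd A p (ecneg q)) (ecadd A p q) = ecadd A p p.
Proof.
case: p q => [|x1 y1] [|x2 y2] //.
  by move=> _ h; rewrite /= !eqxx.
move=> h1 h2; have h2' : oncurve A B (EPt x2 (- y2)) by rewrite (oncurve_neg (EPt x2 y2)).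
have [ex|nx] := eqVneq x1 x2.
  rewrite -ex in h2 h2' *; case: (oncurve_same_x h1 h2) => ->.
    by rewrite [ecadd _ _ (ecneg _)]/= opprK !eqxx.
  by rewrite [ecadd _ _ (EPt x1 y2)]/= !eqxx ecadd0 /= opprK.
(* If 2p = O, then p + q = -(p - q). *)
have [y10|ny1] := eqVneq y1 0.
  rewrite y10 in h1 *; rewrite [RHS]/= oppr0 !eqxx.
  have -> : ecadd A (EPt x1 0) (EPt x2 y2) = ecneg (ecadd A (EPt x1 0) (EPt x2 (- y2))).
    by rewrite (ecneg_add h1 h2') /ecneg opprK oppr0.
  by rewrite ecaddC ?ecaddN ?oncurve_neg ?oncurve_add.
(* If q = -q, both sums agree and the claim is 2(p + q) = 2p. *)
have [y20|ny2] := eqVneq y2 0.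
  rewrite /ecneg y20 oppr0; rewrite y20 in h2 h2'.
  have hs := oncurve_add h1 h2.
  have := ecadd_secant h1 h2 nx; rewrite subr0 => es.
  (* If p + q were its own negative, cancelling q would give p = -p, against [ny1]. *)
  have [y30|ny3] := eqVneq (y1 / (x1 - x2) * (x1 - ((y1 / (x1 - x2)) ^+ 2 - x1 - x2)) - y1) 0.
    have e : ecneg (ecadd A (EPt x1 y1) (EPt x2 0)) = ecadd A (EPt x1 y1) (EPt x2 0).
      by rewrite es /chord /= y30 oppr0.
    have h1' : oncurve A B (EPt x1 (- y1)) by rewrite (oncurve_neg (EPt x1 y1)).
    have := ecaddK h1 h2; rewrite -e (ecneg_add h1 h2) (ecaddK h1').
      by case=> /eqP; rewrite -subr_eq0 -opprD oppr_eq0 -mulr2n mulrn_eq0 (negPf ny1).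
    by rewrite oncurve_neg.
  rewrite es ecadd_tangent // ecadd_tangent //.
  have [_] : slope x1 y1 x2 0 (y1 / (x1 - x2)).
    case: (ecaddP h1 h2) => [ex|m sl _]; first by rewrite ex eqxx in nx.
    by case: (sl) => s1 _; rewrite -[in y1 / _](subr0 y1) s1 mulfK // subr_eq0.
  rewrite addr0 => hA.
  have [eX eY] := translate_double_identity nx ny1 ny3 hA.
  by congr EPt.
rewrite (ecadd_secant h1 h2 nx) (ecadd_secant h1 h2' nx) opprK ecadd_tangent //.
have [_ hA] : slope x1 y1 x2 y2 ((y1 - y2) / (x1 - x2)).
  case: (ecaddP h1 h2) => [ex|m sl _]; first by rewrite ex eqxx in nx.
  by case: (sl) => s1 _; rewrite s1 mulfK // subr_eq0.
have [nx34 [eX eY]] := sum_difference_identity nx ny1 ny2 hA.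
rewrite -[chord x1 y1 x2 _]/(EPt _ _) -[chord x1 y1 x2 (_ / _)]/(EPt _ _).
rewrite ecadd_secant //; first by congr EPt.
- by have := oncurve_add h1 h2'; rewrite (ecadd_secant h1 h2' nx) opprK.
- by have := oncurve_add h1 h2; rewrite (ecadd_secant h1 h2 nx).
Qed.

(** Cases with a sum equal to O or an outer doubling follow from cancellation and
    [ecadd_sum_difference]; collinear points come next, and the rest is [associativity_identity]. *)
Lemma ecaddA p q r : oncurve A B p -> oncurve A B q -> oncurve A B r ->
  ecadd A p (ecadd A q r) = ecadd A (ecadd A p q) r.
Proof.
case: p q r => [|x1 y1] [|x2 y2] [|x3 y3] //; try by rewrite !ecadd0.
move ep : (EPt x1 y1) => p; move eq : (EPt x2 y2) => q; move er : (EPt x3 y3) => r.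
move=> hp hq hr.
have hN s : oncurve A B s -> oncurve A B (ecneg s) by rewrite oncurve_neg.
have hD := oncurve_add.
have [qNp|nqNp] := eqVneq q (ecneg p).
  have := ecaddKr (hN _ hp) hr; rewrite ecnegK -qNp => ->.
  by rewrite qNp [ecadd A p _]ecaddC ?ecaddN ?hN.
have [qNr|nqNr] := eqVneq q (ecneg r).
  have := ecaddK hp (hN _ hr); rewrite ecnegK -qNr => ->.
  by rewrite qNr ecaddN // ecadd0.
have [rNpq|nrNpq] := eqVneq r (ecneg (ecadd A p q)).
  rewrite rNpq [RHS]ecaddC ?ecaddN ?hN ?hD // ecneg_add // [ecadd A (ecneg p) _]ecaddC ?hN //.
  have := ecaddKr (hN _ hq) (hN _ hp); rewrite ecnegK => ->.
  by rewrite ecaddC ?ecaddN ?hN.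
have [pNqr|npNqr] := eqVneq p (ecneg (ecadd A q r)).
  rewrite [in LHS]pNqr ecaddN ?hD // pNqr ecneg_add // [ecadd A _ (ecneg r)]ecaddC ?hN //.
  have := ecaddK (hN _ hr) (hN _ hq); rewrite ecnegK => ->.
  by rewrite ecaddN.
have [rpq|nrpq] := eqVneq r (ecadd A p q).
  have := ecadd_sum_difference hr hq.
  by rewrite [in ecadd A r (ecneg q)]rpq ecaddK // [ecadd A r q]ecaddC // -rpq.
have [pqr|npqr] := eqVneq p (ecadd A q r).
  have := ecadd_sum_difference hp hq.
  rewrite [in ecadd A p (ecneg q)]pqr [ecadd A q r]ecaddC // ecaddK //.
  by rewrite -[ecadd A r q]ecaddC // -pqr [ecadd A r _]ecaddC ?hD // => ->.
have [l sl epq] : exists2 l, slope x1 y1 x2 y2 l & ecadd A p q = chord x1 y1 x2 l.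
  move: nqNp; rewrite -ep -eq in hp hq *.
  by case: (ecaddP hp hq) => [-> ->|l sl _ _]; [rewrite /= opprK eqxx | exists l].
have [m sm eqr] : exists2 m, slope x2 y2 x3 y3 m & ecadd A q r = chord x2 y2 x3 m.
  move: nqNr; rewrite -eq -er in hq hr *.
  by case: (ecaddP hq hr) => [-> ->|m sm _ _]; [rewrite eqxx | exists m].
have hpq := hD _ _ hp hq; have hqr := hD _ _ hq hr.
have [[s1 t1] [s2 t2]] := (sl, sm).
(* With equal slopes the points are collinear, and [on_chord] leaves r = p, p = q = r, or a case
   already excluded. *)
have [elm|nlm] := eqVneq l m.
  have onl : y3 = y1 + l * (x3 - x1) by rewrite -elm in s2; lra.
  have onm : y1 = y2 + m * (x1 - x2) by rewrite elm in s1; lra.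
  have [hp' hq' hr'] : [/\ oncurve A B (EPt x1 y1), oncurve A B (EPt x2 y2) & oncurve A B (EPt x3 y3)].
    by rewrite ep eq er.
  case: (on_chord hp' hr' sl onl); rewrite er -?epq ?ep ?eq => rE.
  - by rewrite rE [RHS]ecaddC // [ecadd A q p]ecaddC.
  - case: (on_chord hq' hp' sm onm); rewrite ep -?eqr ?eq ?er => pE.
    + by rewrite rE pE [RHS]ecaddC ?hD.
    + by rewrite pE rE [RHS]ecaddC ?hD.
    + by rewrite -pE eqxx in npNqr.
  - by rewrite -rE eqxx in nrNpq.
rewrite epq eqr in nrpq nrNpq npqr npNqr hpq hqr *; rewrite -ep -er in hp hr nrpq nrNpq npqr npNqr *.
(* Equal abscissas would mean r = p + q or r = -(p + q), both excluded. *)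
have nx12 : l ^+ 2 - x1 - x2 != x3.
  apply/eqP => e; rewrite /chord e in nrpq nrNpq hpq.
  by case: (oncurve_same_x hr hpq) => ey; [move: nrpq | move: nrNpq]; rewrite /= ey eqxx.
have nx23 : x1 != m ^+ 2 - x2 - x3.
  apply/eqP => e; rewrite /chord -e in npqr npNqr hqr.
  by case: (oncurve_same_x hp hqr) => ey; [move: npqr | move: npNqr]; rewrite /= ey eqxx.
rewrite /chord in hpq hqr *; rewrite !ecadd_secant //.
have [eX eY] := associativity_identity s1 s2 t1 t2 nlm nx12 nx23
  erefl erefl erefl erefl erefl erefl.
by congr EPt.
Qed.

End Slopes.

(** * The rational points as an abelian group *)

Record ecgroup (A B : rat) (ns : ec_nonsingular A B) :=
  ECGroup { ecgroup_val :> ecpt; _ : oncurve A B ecgroup_val }.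

Section GroupInstance.
Variables (A B : rat) (ns : ec_nonsingular A B).
Local Notation G := (ecgroup ns).

HB.instance Definition _ := [isSub for @ecgroup_val A B ns].
HB.instance Definition _ := [Choice of G by <:].

Definition ecgroup_zero : G := ECGroup ns (isT : oncurve A B EInf).
Definition ecgroup_opp (p : G) : G :=
  ECGroup ns (etrans (oncurve_neg A B p) (valP p)).
Definition ecgroup_add (p q : G) : G := ECGroup ns (oncurve_add (valP p) (valP q)).

Lemma ecgroup_addA : associative ecgroup_add.
Proof. by move=> p q r; apply: val_inj; apply: (ecaddA ns) (valP p) (valP q) (valP r). Qed.
Lemma ecgroup_addC : commutative ecgroup_add.
Proof. by move=> p q; apply: val_inj; apply: ecaddC (valP p) (valP q). Qed.
Lemma ecgroup_add0 : left_id ecgroup_zero ecgroup_add.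
Proof. by move=> p; apply: val_inj. Qed.
Lemma ecgroup_addN : left_inverse ecgroup_zero ecgroup_opp ecgroup_add.
Proof. by move=> p; apply: val_inj; apply: ecaddN (valP p). Qed.

HB.instance Definition _ := GRing.isZmodule.Build G
  ecgroup_addA ecgroup_addC ecgroup_add0 ecgroup_addN.

Lemma val_ecgroup0 : val (0 : G) = EInf. Proof. by []. Qed.
Lemma val_ecgroupN (p : G) : val (- p) = ecneg (val p). Proof. by []. Qed.
Lemma val_ecgroupD (p q : G) : val (p + q) = ecadd A (val p) (val q). Proof. by []. Qed.

Lemma val_ecgroup_mulz (p : G) (n : int) : val (p *~ n) = ecmulz A n (val p).
Proof.
have valMn m : val (p *+ m) = ecmuln A m (val p).
  by elim: m => [|m IH] //; rewrite mulrS /ecmuln iterS -/(ecmuln A m _) -IH.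
case: n => n; first exact: valMn.
by rewrite -[ecmulz A (Negz n) _]/(ecneg (ecmuln A n.+1 _)) -valMn.
Qed.

End GroupInstance.

(** * Localization at a prime *)

(* The primality proof is an argument so that the subring structure can be
   inferred from the predicate. *)
Definition plocal (p : nat) (_ : prime p) : {pred rat} :=
  fun x => ~~ (p %| `|denq x|)%N.

Section PLocal.
Variables (p : nat) (pp : prime p).
Local Notation O := (plocal pp).

Lemma plocal_frac (n d : int) : ~~ (p %| `|d|)%N -> n%:~R / d%:~R \in O.
Proof.
move=> pd; set x := _ / _; rewrite unfold_in; apply: contra pd => pden.
have [->|d0] := eqVneq d 0; first by rewrite dvdn0.
have e : n * denq x = numq x * d.
  apply: (@intr_inj rat); rewrite !rmorphM /= numqE /x; field.
  by rewrite intr_eq0.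
have : (`|denq x| %| `|d|)%N.
  have cop : coprime `|denq x| `|numq x| by rewrite coprime_sym coprime_num_den.
  by rewrite -(Gauss_dvdr _ cop) -abszM -e abszM dvdn_mull.
exact: dvdn_trans.
Qed.

Lemma plocalE x : x \in O ->
  exists2 nd : int * int, ~~ (p %| `|nd.2|)%N & x = nd.1%:~R / nd.2%:~R.
Proof. by move=> h; exists (numq x, denq x); rewrite ?divq_num_den. Qed.

Lemma plocal_subring : subring_closed O.
Proof.
have nz (d : int) : ~~ (p %| `|d|)%N -> d%:~R != 0 :> rat.
  by move=> hd; rewrite intr_eq0; apply: contraNneq hd => ->; rewrite dvdn0.
split.
- by have := @plocal_frac 1 1; rewrite divr1; apply; rewrite dvdn1; case: (p) pp => [|[]].
- move=> _ _ /plocalE[[n d] /= hd ->] /plocalE[[m e] /= he ->].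
  have -> : n%:~R / d%:~R - m%:~R / e%:~R = (n * e - m * d)%:~R / (d * e)%:~R :> rat.
    by rewrite rmorphB /= !rmorphM /=; field; rewrite !nz.
  by apply: plocal_frac; rewrite abszM Euclid_dvdM // negb_or hd.
- move=> _ _ /plocalE[[n d] /= hd ->] /plocalE[[m e] /= he ->].
  rewrite mulrACA -invfM -!rmorphM /=.
  by apply: plocal_frac; rewrite abszM Euclid_dvdM // negb_or hd.
Qed.

HB.instance Definition _ := GRing.isSubringClosed.Build rat O plocal_subring.

Lemma plocal_int (n : int) : n%:~R \in O. Proof. exact: rpred_int. Qed.

(** Several valuation arguments below end by exhibiting 1/p as a local element. *)
Lemma plocal_invp : p%:R^-1 \notin O.
Proof.
rewrite unfold_in negbK; have /= := @coprimeq_den 1 p%:Z.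
rewrite coprime1n => /(_ isT).
by rewrite -[p%:Z == 0]/(p == 0)%N (gtn_eqF (prime_gt0 pp)) mul1r -pmulrn => ->.
Qed.

Lemma plocal_unit u : u \in O -> 1 + p%:R * u != 0 /\ (1 + p%:R * u)^-1 \in O.
Proof.
move=> /plocalE[[n d] /= hd ->].
have hn : ~~ (p %| `|(d + p%:Z * n)%R|)%N.
  have E k : (p %| `|k|)%N = (p%:Z %| k)%Z by [].
  apply: contra hd; rewrite !E => h.
  by rewrite -(rpredDr _ (dvdz_mulr n (dvdzz p%:Z))).
have nz (k : int) : ~~ (p %| `|k|)%N -> k%:~R != 0 :> rat.
  by move=> hk; rewrite intr_eq0; apply: contraNneq hk => ->; rewrite dvdn0.
have e : 1 + p%:R * (n%:~R / d%:~R) = (d + p%:Z * n)%:~R / d%:~R :> rat.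
  by rewrite rmorphD rmorphM /= -pmulrn; field; rewrite nz.
rewrite e mulf_neq0 ?invr_neq0 ?nz //; split=> //.
by rewrite invfM invrK mulrC plocal_frac.
Qed.

(** Valuation ring property: if p divides the denominator of a reduced fraction, the numerator is
    prime to p. *)
Lemma plocal_inv x : x \notin O -> exists2 u, u \in O & x^-1 = p%:R * u.
Proof.
rewrite unfold_in negbK => pden; have /dvdnP[k hk] := pden.
have pnum : ~~ (p %| `|numq x|)%N.
  apply/negP => pnum; have := dvdn_gcd p `|numq x| `|denq x|.
  by rewrite (eqP (coprime_num_den x)) pnum pden dvdn1 => /eqP p1; move: (pp); rewrite p1.
exists (k%:Z%:~R / (numq x)%:~R); first exact: plocal_frac.
rewrite -{1}(divq_num_den x) invfM invrK -[denq x]absz_denq hk PoszM rmorphM /= -pmulrn.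
by ring.
Qed.

(** Integral closedness: for z = 1/(p u), the product p^n z^(n+1) u^(n+1) is 1/p. *)
Lemma plocal_root n (z : rat) : z ^+ n.+1 \in O -> z \in O.
Proof.
move=> hz; apply: contraT => /[dup] nz /plocal_inv[u hu e].
have z0 : z != 0 by apply: contraNneq nz => ->; apply: rpred0.
have p0 : p%:R != 0 :> rat by rewrite pnatr_eq0 -lt0n prime_gt0.
case/negP: plocal_invp.
have -> : p%:R^-1 = p%:R ^+ n * (z ^+ n.+1 * u ^+ n.+1).
  rewrite -exprMn; have -> : z * u = p%:R^-1 by apply: (mulfI p0); rewrite mulrCA -e !divff.
  by rewrite exprS exprVn; field; rewrite expf_neq0.
by rewrite rpredM ?rpredX ?rpred_nat // (rpredM hz) // rpredX.
Qed.

End PLocal.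

Ltac plocal_closed :=
  repeat lazymatch goal with
  | |- is_true (_ + _ \in _) => apply: rpredD
  | |- is_true (- _ \in _) => rewrite rpredN
  | |- is_true (_ * _ \in _) => apply: rpredM
  | |- is_true (_ ^+ _ \in _) => apply: rpredX
  | |- is_true (_%:R \in _) => apply: rpred_nat
  | |- is_true (1 \in _) => apply: rpred1
  | _ => assumption
  end.

(** * The subgroup of points reducing to infinity *)

Section PlocalFiltration.
Variables (p : nat) (pp : prime p) (A B s : rat).
Local Notation O := (plocal pp).
Hypotheses (s0 : s != 0) (As : A / s ^+ 2 \in O) (Bs : B / s ^+ 3 \in O).

(* The points reducing to infinity on the model of the curve with abscissa x / s. *)
Definition far (q : ecpt) : bool := if q is EPt x _ then x / s \notin O else true.

Lemma ecadd_far_near q r : oncurve A B q -> oncurve A B r ->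
  far q -> ~~ far r -> ~~ far (ecadd A q r).
Proof.
case: q r => [|x1 y1] [|x2 y2] //= /[dup] h1 /eqP e1 /[dup] h2 /eqP e2.
move=> fq /negbNE nr.
have nx : x1 != x2 by apply: contraNneq fq => ->.
have nx' : x2 - x1 != 0 by rewrite subr_eq0 eq_sym.
rewrite (negPf nx) /= negbK.
have [u hu eu] := plocal_inv fq.
have x10 : x1 != 0 by apply: contraNneq fq => ->; rewrite mul0r rpred0.
set X : rat := x1 / s in eu fq; set Y : rat := x2 / s in nr.
have X0 : X != 0 by rewrite mulf_neq0 ?invr_neq0.
have hi : X^-1 \in O by rewrite eu rpredM ?rpred_nat.
have huY : - (u * Y) \in O by rewrite rpredN rpredM.
have [d0 hd] := plocal_unit huY.
have ed : 1 + p%:R * - (u * Y) = 1 - Y / X by rewrite mulrN mulrA -eu mulrC.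
rewrite ed in d0 hd.
(* Ordinates scale by s^(3/2), so only their product is normalized. The curve equations make
   [w ^+ 2] integral, hence also [w]; the chord formula then has the unit 1 - Y/X as its only
   denominator besides X. *)
set w : rat := y1 * y2 / s ^+ 3 / X ^+ 2.
have hw : w \in O.
  apply: (@plocal_root _ _ 1).
  have -> : w ^+ 2 = (X^-1 + A / s ^+ 2 * X^-1 ^+ 3 + B / s ^+ 3 * X^-1 ^+ 4) *
     (Y ^+ 3 + A / s ^+ 2 * Y + B / s ^+ 3).
    have -> : w ^+ 2 = y1 ^+ 2 * y2 ^+ 2 / s ^+ 6 / X ^+ 4 by rewrite /w; field; rewrite s0 X0.
    by rewrite e1 e2 /X /Y; field; rewrite s0 x10.
  move: (A / s ^+ 2) (B / s ^+ 3) As Bs => al be hal hbe.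
  by plocal_closed.
have -> : (((y2 - y1) / (x2 - x1)) ^+ 2 - x1 - x2) / s =
   ((Y + A / s ^+ 2 / X) * (1 + Y / X) + 2 * (B / s ^+ 3) * X^-1 ^+ 2 - 2 * w)
   * (1 - Y / X)^-1 ^+ 2.
  have -> : ((y2 - y1) / (x2 - x1)) ^+ 2 = (y2 ^+ 2 + y1 ^+ 2 - 2 * (y1 * y2)) / (x2 - x1) ^+ 2.
    by field.
  rewrite e1 e2 /w /X /Y; field.
  by rewrite s0 nx' x10 /= subr_eq0 nx.
move: (A / s ^+ 2) (B / s ^+ 3) As Bs => al be hal hbe.
by plocal_closed.
Qed.

Variable ns : ec_nonsingular A B.

Lemma far_zmod_closed : zmod_closed (fun q : ecgroup ns => far (val q)).
Proof.
have farN q : far (ecneg q) = far q by case: q.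
have farD (q r : ecgroup ns) : far (val q) -> far (val r) -> far (val (q + r)).
  (* If q + r were near, then so would be r = - q + (q + r). *)
  move=> fq fr; apply: contraT => nqr.
  have := ecadd_far_near (valP (- q)) (valP (q + r)).
  by rewrite -val_ecgroupD addKr val_ecgroupN farN fr; apply.
split=> // q r fq fr; apply: farD => //.
by rewrite val_ecgroupN farN.
Qed.

End PlocalFiltration.

(** * Integer relations between three points *)

Lemma mulrzAC2 (V : zmodType) (v : V) (n : int) : v *+ 2 *~ n = v *~ n *+ 2.
Proof. by rewrite !pmulrn mulrzAC. Qed.

Section Parity.
Variables (V : zmodType) (K : zmodClosed V).

Lemma int_parity (n : int) : exists k (e : bool), n = k * 2 + e%:Z.
Proof.
exists (n %/ 2)%Z, (n %% 2 == 1)%Z; rewrite {1}(divz_eq n 2); congr (_ + _).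
have := modz_ge0 n (isT : 2 != 0 :> int); have := ltz_mod n (isT : 2 != 0 :> int).
by case: (n %% 2)%Z => [[|[|k]]|].
Qed.

(** Modulo K the relation reads (x + z) P + y Q = 0, and there P and Q span a copy of (Z/2)^2. *)
Lemma relation_even_sum (P Q R : V) (x y z : int) :
  P *+ 2 \in K -> Q *+ 2 \in K -> P - R \in K ->
  P \notin K -> Q \notin K -> P + Q \notin K ->
  P *~ x + Q *~ y + R *~ z = 0 ->
  (exists k, x + z = k * 2) /\ (exists k, y = k * 2).
Proof.
move=> P2 Q2 PR nP nQ nPQ rel.
have [k [e1 ek]] := int_parity (x + z); have [m [e2 em]] := int_parity y.
have : P *~ e1%:Z + Q *~ e2%:Z \in K.
  have -> : P *~ e1%:Z + Q *~ e2%:Z = (P - R) *~ z - P *+ 2 *~ k - Q *+ 2 *~ m.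
    have ez : x = k * 2 + e1%:Z - z by rewrite -ek addrK.
    rewrite ez em !mulrzDr mulrNz in rel.
    have -> : P *+ 2 *~ k = P *~ (k * 2) by rewrite mulrC mulrzA.
    have -> : Q *+ 2 *~ m = Q *~ (m * 2) by rewrite mulrC mulrzA.
    apply/eqP; rewrite mulrzBl -subr_eq0 !opprD !opprK !addrA; apply/eqP.
    by rewrite -[RHS]rel !addrA [RHS](ACl (2*5*3*6*1*4)).
  by rewrite !rpredB // rpredMz.
by case: e1 e2 ek em => [] [] /= ek em; rewrite ?addr0 ?add0r ?(negPf nP) ?(negPf nQ) ?(negPf nPQ) // => _; split; [exists k | exists m]; rewrite ?ek ?em addr0.
Qed.

(** The doubled relation puts 2z R in K; for odd z, having 4R in K would put 2R there. *)
Lemma relation_even (P Q R : V) (x y z : int) :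
  P *+ 2 \in K -> Q *+ 2 \in K -> R *+ 2 *+ 2 \in K -> R *+ 2 \notin K ->
  P *~ x + Q *~ y + R *~ z = 0 -> exists k, z = k * 2.
Proof.
move=> P2 Q2 R4 nR rel; have [k [[] ek]] := int_parity z; last by exists k; rewrite ek addr0.
case/negP: nR.
have -> : R *+ 2 = - (P *+ 2 *~ x + Q *+ 2 *~ y + R *+ 2 *+ 2 *~ k).
  apply/eqP; rewrite -addr_eq0 addrC -addrA; apply/eqP.
  have -> : R *+ 2 *+ 2 *~ k + R *+ 2 = R *~ z *+ 2.
    by rewrite ek mulrzDr [RHS]mulrnDl mulrzA !mulrzAC2.
  by rewrite !mulrzAC2 -!mulrnDl rel mul0rn.
by rewrite rpredN !rpredD // rpredMz.
Qed.
End Parity.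

(** Descent on |x| + |y| + |z|: without 2-torsion an even relation can be halved. *)
Lemma relation_descent (V : zmodType) (P Q R : V) :
  (forall v : V, v *+ 2 = 0 -> v = 0) ->
  (forall x y z : int, P *~ x + Q *~ y + R *~ z = 0 ->
     [/\ exists k, x = k * 2, exists k, y = k * 2 & exists k, z = k * 2]) ->
  forall x y z : int, P *~ x + Q *~ y + R *~ z = 0 -> [/\ x = 0, y = 0 & z = 0].
Proof.
move=> no2 even x y z.
have [n] := ubnP (`|x| + `|y| + `|z|)%N; elim: n x y z => // n IH x y z le rel.
have [[x' ex] [y' ey] [z' ez]] := even _ _ _ rel; subst x y z.
have rel' : P *~ x' + Q *~ y' + R *~ z' = 0.
  by apply: no2; rewrite !mulrnDl -rel !mulrzA.
have [|x0] := boolP ((`|x'| + `|y'| + `|z'|)%N == 0)%N.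
  by rewrite !addn_eq0 !absz_eq0 => /andP[/andP[/eqP-> /eqP->] /eqP->].
have [|-> -> ->//] := IH _ _ _ _ rel'.
by move: le x0; rewrite !abszM; lia.
Qed.

(** Eliminating z and y gives (2x + 1)(P - R) + 2(k R + m Q) = 0, from which a half of P - R is read
    off. *)
Lemma relation_odd_halving (V : zmodType) (P Q R : V) (x y z k m : int) :
  P *~ (x * 2 + 1) + Q *~ y + R *~ z = 0 -> x * 2 + 1 + z = k * 2 -> y = m * 2 ->
  exists S : V, S *+ 2 = P - R.
Proof.
move=> rel ez ey; exists (- ((P - R) *~ x + R *~ k + Q *~ m)).
have {}ez : z = k * 2 - (x * 2 + 1) by rewrite -ez; ring.
have d (v : V) j : v *~ (j * 2) = v *~ j *+ 2 by rewrite mulrzA.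
apply/eqP; rewrite -subr_eq0; apply/eqP; rewrite -[RHS]oppr0 -[in RHS]rel ez ey.
rewrite mulrzBr !mulrzDr !d !mulr1z mulrzBl !mulr2n !opprD !opprK !addrA.
by rewrite [RHS](ACl (1*8*6*4*2*9*7*5*3*10)).
Qed.

(** * The curve y^2 = x^3 - a^2 x + b^6 *)

(** For v = m/n in lowest terms, n^4 N = M is odd if m, n have opposite parity. If both are odd, M
    is 4 times an odd number, and 4 divides m n (m^2 - n^2) as well. *)
Lemma halving_parameter_plocal2 (v : rat) (pr2 : prime 2) :
  let N := v ^+ 4 - 4 * v ^+ 3 - 6 * v ^+ 2 - 4 * v + 1 in
  N != 0 /\ v * (v ^+ 2 - 1) / N \in plocal pr2.
Proof.
move=> N; set m := numq v; set n := denq v.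
have n0 : n%:~R != 0 :> rat by rewrite intr_eq0 denq_neq0.
have ev : v = m%:~R / n%:~R by rewrite divq_num_den.
pose M : int := (m - n) ^+ 4 - 12 * (m * n) ^+ 2.
have eN : N = M%:~R / n%:~R ^+ 4.
  by rewrite /N /M ev !(rmorphB, rmorphXn, rmorphM) /=; field.
(* Here [e] is the common factor, 4 or 1, whose cancellation leaves the odd denominator [d]. *)
have odd_case (e c d : int) : c * 2 + 1 = d -> e * d = M -> e != 0 ->
    (exists f, m * n * (m ^+ 2 - n ^+ 2) = e * f) ->
    N != 0 /\ v * (v ^+ 2 - 1) / N \in plocal pr2.
  move=> ed eM e0 [f ef].
  have dodd : ~~ (2 %| `|d|)%N by rewrite -ed; lia.
  have d0 : d != 0 by rewrite -ed; lia.
  have de0 : e%:~R != 0 :> rat by rewrite intr_eq0.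
  have dd0 : d%:~R != 0 :> rat by rewrite intr_eq0.
  have N0 : N != 0.
    by rewrite eN mulf_neq0 ?invr_neq0 ?expf_neq0 // -eM intrM mulf_neq0.
  split=> //; have -> : v * (v ^+ 2 - 1) / N = f%:~R / d%:~R; last exact: plocal_frac.
  rewrite eN -eM ev intrM.
  have -> : f%:~R = (m * n * (m ^+ 2 - n ^+ 2))%:~R / e%:~R :> rat by rewrite ef intrM; field.
  by rewrite !(rmorphB, rmorphXn, rmorphM) /=; field; rewrite n0 de0 dd0.
have [i [e1 em]] := int_parity m; have [j [e2 en]] := int_parity n.
case: e1 e2 em en => [] [] /= em en.
- pose w := 2 * i * j + i + j.
  apply: (odd_case 4 (2 * (i - j) ^+ 4 - 6 * w ^+ 2 - 6 * w - 2)
    (4 * (i - j) ^+ 4 - 12 * w ^+ 2 - 12 * w - 3)) => //; first by ring.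
    by rewrite /M em en /w; ring.
  by exists (m * n * (i ^+ 2 + i - j ^+ 2 - j)); rewrite em en; ring.
- pose k := i - j.
  apply: (odd_case 1 (8 * k ^+ 4 + 16 * k ^+ 3 + 12 * k ^+ 2 + 4 * k - 6 * (m * n) ^+ 2) M) => //.
  + by rewrite /M em en /k; ring.
  + by rewrite mul1r.
  + by exists (m * n * (m ^+ 2 - n ^+ 2)); rewrite mul1r.
- pose k := i - j - 1.
  apply: (odd_case 1 (8 * k ^+ 4 + 16 * k ^+ 3 + 12 * k ^+ 2 + 4 * k - 6 * (m * n) ^+ 2) M) => //.
  + by rewrite /M em en /k; ring.
  + by rewrite mul1r.
  + by exists (m * n * (m ^+ 2 - n ^+ 2)); rewrite mul1r.
- have := coprime_num_den v; rewrite -/m -/n em en !addr0 !abszM /=.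
  by rewrite /coprime -muln_gcdl => /eqP; lia.
Qed.

(** The chord through P and -R, of slope c, and the tangent at S, of slope l, both pass through -2S
    = R - P. Eliminating S leaves a quartic in l, normalized by v = (c - l)/b. *)
Lemma halve_P_sub_R (a b : rat) (S : ecpt) (A := - a ^+ 2) (B := b ^+ 6) :
  b != 0 -> oncurve A B S ->
  ecadd A S S = ecadd A (EPt 0 (b ^+ 3)) (ecneg (EPt (- b ^+ 2) (a * b))) ->
  exists v, 4 * a * (v * (v ^+ 2 - 1)) =
    b ^+ 2 * (v ^+ 4 - 4 * v ^+ 3 - 6 * v ^+ 2 - 4 * v + 1).
Proof.
move=> b0 hS; have b20 : 0 != - b ^+ 2 by rewrite eq_sym oppr_eq0 expf_neq0.
have hP : oncurve A B (EPt 0 (b ^+ 3)) by apply/eqP; rewrite /A /B; ring.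
have hR : oncurve A B (ecneg (EPt (- b ^+ 2) (a * b))) by apply/eqP; rewrite /A /B; ring.
rewrite (ecadd_secant hP hR b20).
have -> : (b ^+ 3 - - (a * b)) / (0 - - b ^+ 2) = (b ^+ 2 + a) / b by field.
case: S hS => [|x y] // hS; case: (ecaddP hS hS) => // l [_ sl] _ [ex ey].
exists ((b ^+ 2 + a) / b ^+ 2 - l / b).
set c := (b ^+ 2 + a) / b in ex ey.
have ea : a = b * c - b ^+ 2 by rewrite /c; field.
have {}ex : x = (l ^+ 2 - (c ^+ 2 + b ^+ 2)) / 2 by lra.
have {}ey : y = l * (x - (c ^+ 2 + b ^+ 2)) + c * (c ^+ 2 + b ^+ 2) + b ^+ 3.
  have ex2 : l ^+ 2 - x - x = c ^+ 2 + b ^+ 2 by rewrite ex; field.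
  by move: ey; rewrite ex2; lra.
apply/eqP; rewrite -subr_eq0; apply/eqP.
move: sl; rewrite /A ey ex ea => /eqP; rewrite -subr_eq0 => /eqP e.
rewrite -[RHS](mulr0 (- 4 / b ^+ 2)) -e.
by field.
Qed.

(** In the duplication formula all terms except W^4, with W = x/s a 2-adic unit, carry a factor 4
    when the new abscissa is integral; then 1/2 would be integral. *)
Lemma far_double (pr2 : prime 2) (A B s x y al w : rat) :
  s != 0 -> A / s ^+ 2 = 2 * al -> al \in plocal pr2 -> B / s ^+ 3 \in plocal pr2 ->
  x / s = 1 + 2 * w -> w \in plocal pr2 ->
  oncurve A B (EPt x y) -> far pr2 s (ecadd A (EPt x y) (EPt x y)).
Proof.
move=> s0 eA hal hB ex hw h; case: (ecaddP h h) => // l [_ sl] nopp.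
have y0 : y != 0 by apply/eqP => y0; apply: nopp; rewrite y0 oppr0.
have [d0 hd] := plocal_unit hw.
apply/negP => /=; set X := (_ / s) => hX.
case/negP: (plocal_invp pr2).
move/oncurveP: h => h.
have el : l = (3 * x ^+ 2 + A) / (2 * y).
  have -> : 3 * x ^+ 2 + A = l * (y + y) by rewrite sl; ring.
  by field.
set W := x / s in ex; rewrite -ex in d0 hd.
have eX : 4 * X * (W ^+ 3 + A / s ^+ 2 * W + B / s ^+ 3) =
    W ^+ 4 - 2 * (A / s ^+ 2) * W ^+ 2 - 8 * (B / s ^+ 3) * W + (A / s ^+ 2) ^+ 2.
  have -> : W ^+ 3 + A / s ^+ 2 * W + B / s ^+ 3 = y ^+ 2 / s ^+ 3.
    by rewrite h /W; field.
  rewrite /X el; have -> : B = y ^+ 2 - x ^+ 3 - A * x by rewrite h; ring.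
  by rewrite /W; field; rewrite s0 y0.
have hW : W \in plocal pr2 by rewrite ex; plocal_closed.
rewrite eA in eX; move: (B / s ^+ 3) hB eX => be hbe eX.
have -> : 2%:R^-1 = (2 * X * (W ^+ 3 + 2 * al * W + be) + 2 * al * W ^+ 2 +
    4 * be * W - 2 * al ^+ 2) * W^-1 ^+ 4.
  have -> : 2 * X * (W ^+ 3 + 2 * al * W + be) + 2 * al * W ^+ 2 +
    4 * be * W - 2 * al ^+ 2 = W ^+ 4 / 2 by move: (W) (X) eX => W' X' eX'; lra.
  by field.
by plocal_closed.
Qed.

(** * Reductions of P, Q, R and parity of their relations *)

Section Points.
Variables (a b : rat) (ns : ec_nonsingular (- a ^+ 2) (b ^+ 6)).
Hypotheses (a0 : a != 0) (b0 : b != 0).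
Local Notation A := (- a ^+ 2).
Local Notation B := (b ^+ 6).
Local Notation G := (ecgroup ns).

Lemma oncurve_P : oncurve A B (EPt 0 (b ^+ 3)). Proof. by apply/eqP; ring. Qed.
Lemma oncurve_Q : oncurve A B (EPt a (b ^+ 3)). Proof. by apply/eqP; ring. Qed.
Lemma oncurve_R : oncurve A B (EPt (- b ^+ 2) (a * b)). Proof. by apply/eqP; ring. Qed.

Let P : G := ECGroup ns oncurve_P.
Let Q : G := ECGroup ns oncurve_Q.
Let R : G := ECGroup ns oncurve_R.

Let b30 : b ^+ 3 != 0. Proof. by rewrite expf_neq0. Qed.

Lemma val_doubleP : exists y, val (P *+ 2) = EPt (a ^+ 4 / (4 * b ^+ 6)) y.
Proof.
eexists; rewrite mulr2n [LHS]ecadd_tangent ?b30 //.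
by congr EPt; field.
Qed.

Lemma val_doubleQ : exists y, val (Q *+ 2) = EPt (a ^+ 4 / b ^+ 6 - 2 * a) y.
Proof.
eexists; rewrite mulr2n [LHS]ecadd_tangent ?b30 //.
by congr EPt; field.
Qed.

Lemma val_doubleR : exists y,
  val (R *+ 2) = EPt (((3 * b ^+ 4 - a ^+ 2) / (2 * (a * b))) ^+ 2 + 2 * b ^+ 2) y.
Proof.
eexists; rewrite mulr2n [LHS]ecadd_tangent ?mulf_neq0 //.
by congr EPt; field; rewrite a0 b0.
Qed.

Lemma val_addPQ : exists y, val (P + Q) = EPt (- a) y.
Proof.
eexists; rewrite [LHS](ecadd_secant oncurve_P oncurve_Q) 1?eq_sym // subrr mul0r.
by congr EPt; ring.
Qed.

Lemma val_subPR : exists y, val (P - R) = EPt (((b ^+ 2 + a) / b) ^+ 2 + b ^+ 2) y.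
Proof.
have hR : oncurve A B (EPt (- b ^+ 2) (- (a * b))) by apply/eqP; ring.
eexists; rewrite [LHS](ecadd_secant oncurve_P hR) 1?eq_sym ?oppr_eq0 ?expf_neq0 //.
by congr EPt; field.
Qed.

(** With X = x/a the equation is y^2/a^3 = X^3 - X + t^-3. The points P, Q, P + Q have X = 0, 1, -1,
    while 2P, 2Q, P - R have X = t^3/4, t^3 - 2, t + 2 + 2/t, with poles at p. *)
Lemma relation_even_at_pole (p : nat) (pp : prime p) (x y z : int) :
  a / b ^+ 2 \notin plocal pp -> P *~ x + Q *~ y + R *~ z = 0 ->
  (exists k, x + z = k * 2) /\ (exists k, y = k * 2).
Proof.
move=> /[dup] nt /plocal_inv[u hu eu]; set t := a / b ^+ 2 in nt eu *.
have t0 : t != 0 by rewrite mulf_neq0 ?invr_neq0 ?expf_neq0.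
have hi : t^-1 \in plocal pp by rewrite eu; plocal_closed.
have hA : A / a ^+ 2 \in plocal pp.
  by have -> : A / a ^+ 2 = - 1 by [field]; plocal_closed.
have hB : B / a ^+ 3 \in plocal pp.
  have -> : B / a ^+ 3 = t^-1 ^+ 3 by rewrite /t; field; rewrite a0 b0.
  by plocal_closed.
pose K : zmodClosed G := HB.pack (fun q : G => far pp a (val q))
  (GRing.isZmodClosed.Build G _ (far_zmod_closed a0 hA hB ns)).
have KE q : (q \in K) = far pp a (val q) by [].
apply: (@relation_even_sum _ K); rewrite ?KE.
- have [w ->] := val_doubleP; apply: contra nt => h; apply: (@plocal_root _ _ 2).
  have -> : t ^+ 3 = 4 * (a ^+ 4 / (4 * b ^+ 6) / a) by rewrite /t; field; rewrite a0 b0.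
  by rewrite rpredM ?rpred_nat.
- have [w ->] := val_doubleQ; apply: contra nt => h; apply: (@plocal_root _ _ 2).
  have -> : t ^+ 3 = (a ^+ 4 / b ^+ 6 - 2 * a) / a + 2 by rewrite /t; field; rewrite a0 b0.
  by rewrite rpredD ?rpred_nat.
- have [w ->] := val_subPR; apply: contra nt => h.
  have -> : t = (((b ^+ 2 + a) / b) ^+ 2 + b ^+ 2) / a - (2 * t^-1 + 2).
    by rewrite /t; field; rewrite a0 b0.
  by rewrite rpredB //; plocal_closed.
- by rewrite /= mul0r rpred0.
- by rewrite /= divff ?rpred1.
- by have [w ->] := val_addPQ; rewrite /= mulNr divff // rpredN rpred1.
Qed.

(** The scale s = a^2/(4 b^2) is the 2-adically leading term of the abscissa of 2R, which becomes
    odd. Those of 2P and 2Q become t^2 and 4 t^2 - 8/t, with poles at 2 since 1/t = 4u. *)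
Lemma relation_even_at_pole2 (pr2 : prime 2) (u : rat) (x y z : int) :
  u \in plocal pr2 -> b ^+ 2 / a = 4 * u -> P *~ x + Q *~ y + R *~ z = 0 ->
  exists k, z = k * 2.
Proof.
move=> hu eu; set s := a ^+ 2 / (4 * b ^+ 2).
have nz4 : 4 != 0 :> rat by [].
have s0 : s != 0 by rewrite mulf_neq0 ?invr_neq0 ?mulf_neq0 ?expf_neq0.
have u0 : u != 0 by apply: contraTneq (mulf_neq0 (expf_neq0 2 b0) (invr_neq0 a0)) => u0; rewrite eu u0 mulr0 eqxx.
have ea : a = b ^+ 2 / (4 * u) by rewrite -eu; field; rewrite a0 b0.
pose al := - 8 * (4 * u) ^+ 2.
have hal : al \in plocal pr2 by rewrite /al mulNr; plocal_closed.
have eA : A / s ^+ 2 = 2 * al.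
  by rewrite /s /al ea; field; rewrite b0 u0.
have hA : A / s ^+ 2 \in plocal pr2 by rewrite eA; plocal_closed.
have hB : B / s ^+ 3 \in plocal pr2.
  have -> : B / s ^+ 3 = 64 * (4 * u) ^+ 6 by rewrite /s ea; field; rewrite b0 u0.
  by plocal_closed.
have half : 2%:R^-1 \notin plocal pr2 := plocal_invp pr2.
pose K : zmodClosed G := HB.pack (fun q : G => far pr2 s (val q))
  (GRing.isZmodClosed.Build G _ (far_zmod_closed s0 hA hB ns)).
have KE q : (q \in K) = far pr2 s (val q) by [].
apply: (@relation_even _ K); rewrite ?KE.
- have [w ->] := val_doubleP; apply: contra half => h.
  have -> : 2%:R^-1 = 2 * u * (4 * u)^-1 by field.
  rewrite rpredM ?rpredM ?rpred_nat //; apply: (@plocal_root _ _ 1).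
  by have <- : a ^+ 4 / (4 * b ^+ 6) / s = (4 * u)^-1 ^+ 2 by rewrite /s ea; field; rewrite b0 u0.
- have [w ->] := val_doubleQ; apply: contra half => h.
  have -> : 2%:R^-1 = u * (2 * u)^-1 by field.
  rewrite rpredM ?rpred_nat //; apply: (@plocal_root _ _ 1).
  have -> : (2 * u)^-1 ^+ 2 = (a ^+ 4 / b ^+ 6 - 2 * a) / s + 32 * u.
    by rewrite /s ea; field; rewrite b0 u0.
  by rewrite rpredD //; plocal_closed.
- have [w e] := val_doubleR; rewrite mulr2n val_ecgroupD e.
  have hc := valP (R *+ 2); rewrite e in hc.
  (* The scaled abscissa of 2R is 1 + 2(4u)^2 + 9(4u)^4. *)
  apply: (far_double s0 eA hal hB _ _ hc (w := 8 * u ^+ 2 * (9 * (4 * u) ^+ 2 + 2))); last by plocal_closed.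
  by rewrite /s ea; field; rewrite b0 u0.
- have [w ->] := val_doubleR; rewrite /far negbK.
  have -> : (((3 * b ^+ 4 - a ^+ 2) / (2 * (a * b))) ^+ 2 + 2 * b ^+ 2) / s =
    (3 * (4 * u) ^+ 2 - 1) ^+ 2 + 8 * (4 * u) ^+ 2 by rewrite /s ea; field; rewrite b0 u0.
  by plocal_closed.
Qed.

Lemma relation_trivial (p : nat) (pp : prime p) :
  a / b ^+ 2 \notin plocal pp -> (forall S : G, S *+ 2 = 0 -> S = 0) ->
  forall x y z : int, P *~ x + Q *~ y + R *~ z = 0 -> [/\ x = 0, y = 0 & z = 0].
Proof.
move=> nt no2; apply: relation_descent => // x y z rel.
have [[k ek] [m em]] := relation_even_at_pole nt rel.
have [j [e ej]] := int_parity x.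
suff [i ei] : exists i, z = i * 2.
  split; [exists (k - i) | by exists m | by exists i].
  by rewrite mulrBl -ek -ei addrK.
case: e ej => /= ej; last first.
  by exists (k - j); rewrite mulrBl -ek ej addr0 addrAC subrr add0r.
(* For odd x, P - R is a double, and the parameter v gives b^2/a = 4 v (v^2 - 1)/N. *)
rewrite ej in rel ek; have [S eS] := relation_odd_halving rel ek em.
have [|v ev] := @halve_P_sub_R a b (val S) b0 (valP S).
  by rewrite -val_ecgroupD -mulr2n eS.
have [] := halving_parameter_plocal2 v (isT : prime 2); set N := (_ + 1) => N0 hv.
apply: (relation_even_at_pole2 hv _ rel).
apply: (mulIf a0); rewrite divfK //; apply: (mulIf N0).
by rewrite -ev; field.
Qed.

End Points.

(** * Consequences of 0 < a < b *)

Section SmallParameter.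
Variables a b : int.
Hypotheses (a0 : 0 < a) (ab : a < b).

(** For c = b^2 the value is positive if n >= -c and negative if n <= -c - 1. *)
Lemma cubic_no_int_root (n : int) : n ^+ 3 - a ^+ 2 * n + b ^+ 6 <> 0.
Proof.
have -> : b ^+ 6 = (b ^+ 2) ^+ 3 by rewrite -exprM.
have : a ^+ 2 < b ^+ 2 by rewrite ltrXn2r //; lia.
have : 0 < a ^+ 2 by rewrite exprn_gt0.
move: (a ^+ 2) (b ^+ 2) => q c q0 qc.
have [n0|n0] := leP 0 n.
  have c3 : c ^+ 2 <= c ^+ 3 by rewrite ler_eXn2l //; lia.
  have [nq|nq] := leP q n.
    have : q * n <= n ^+ 3 by rewrite exprSr ler_wpM2r //; nia.
    nia.
  have : q * n < c ^+ 2 by nia.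
  nia.
have [nc|nc] := leP (- n) c.
  have : (- n) ^+ 3 <= c ^+ 3 by rewrite lerXn2r ?nnegrE //; lia.
  have : (- n) ^+ 3 = - n ^+ 3 by ring.
  nia.
have h1 : c ^+ 2 + c < n ^+ 2 - q by nia.
have h2 : c * (c ^+ 2 + c) < - n * (n ^+ 2 - q) by nia.
have -> : n ^+ 3 - q * n + c ^+ 3 = (c * (c ^+ 2 + c) - - n * (n ^+ 2 - q)) - c ^+ 2 by ring.
nia.
Qed.
Lemma cubic_no_rat_root (x : rat) : x ^+ 3 - a%:~R ^+ 2 * x + b%:~R ^+ 6 <> 0.
Proof.
move=> h; have [x0|x0] := eqVneq x 0.
  move: h; rewrite x0; apply/eqP; rewrite mulr0 subr0 expr0n add0r expf_neq0 //.
  by rewrite intr_eq0; lia.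
have [d1|d1] := eqVneq `|denq x|%N 1%N.
  have ex : x = (numq x)%:~R by rewrite -{1}(divq_num_den x) -[denq x]absz_denq d1 divr1.
  apply: (@cubic_no_int_root (numq x)); apply: (@intr_inj rat).
  by rewrite !(rmorphD, rmorphN, rmorphM, rmorphXn) /= -ex.
have pp : prime (pdiv `|denq x|) by rewrite pdiv_prime // ltn_neqAle eq_sym d1 absz_gt0 denq_neq0.
have nx : x \notin plocal pp by rewrite unfold_in negbK pdiv_dvd.
have [u hu eu] := plocal_inv nx.
case/negP: (plocal_invp pp).
set p := pdiv _ in eu *; have p0 : p%:R != 0 :> rat by rewrite pnatr_eq0 -lt0n prime_gt0.
have ex : x = (p%:R * u)^-1 by rewrite -eu invrK.
have u0 : u != 0 by apply: contraNneq x0 => u0; rewrite ex u0 mulr0 invr0.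
(* The cubic equation at x = 1/(p u), multiplied by p^2 u^3. *)
have -> : p%:R^-1 = p%:R * u ^+ 2 * a%:~R ^+ 2 - p%:R ^+ 2 * u ^+ 3 * b%:~R ^+ 6 :> rat.
  apply/eqP; rewrite -subr_eq0; apply/eqP.
  rewrite -[RHS](mulr0 (p%:R ^+ 2 * u ^+ 3)) -h ex.
  by field; rewrite u0 p0.
have ha := plocal_int pp a; have hb := plocal_int pp b; by plocal_closed.
Qed.

(** A ratio strictly between 0 and 1 is no integer; a prime factor of its denominator feeds
    [relation_trivial]. *)
Lemma denq_ratio_gt1 : (1 < `|denq (a%:~R / b%:~R ^+ 2)|)%N.
Proof.
have b20 : 0 < b%:~R ^+ 2 :> rat by rewrite exprn_gt0 // ltr0z; lia.
rewrite ltn_neqAle absz_gt0 denq_neq0 andbT eq_sym; apply/eqP => d1.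
set t := _ / _ in d1.
have et : t = (numq t)%:~R by rewrite -{1}(divq_num_den t) -[denq t]absz_denq d1 divr1.
have t0 : 0 < t by rewrite divr_gt0 // ltr0z.
have t1 : t < 1.
  rewrite ltr_pdivrMr // mul1r -rmorphXn ltr_int; nia.
by move: t0 t1; rewrite et ltr0z ltrz1; lia.
Qed.

End SmallParameter.

Lemma nonsingular_curve (a b : int) : 0 < a -> a < b ->
  ec_nonsingular (- (a%:~R) ^+ 2) ((b%:~R) ^+ 6).
Proof.
move=> a0 ab; rewrite /ec_nonsingular.
have a1 : 1 <= a%:~R :> rat by rewrite ler1z; lia.
have lt : a%:~R < b%:~R :> rat by rewrite ltr_int.
move: (a%:~R : rat) (b%:~R : rat) a1 lt => x y x1 xy.
have y6 : 1 <= y ^+ 6 by rewrite exprn_ege1 //; lra.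
have lt6 : x ^+ 6 < y ^+ 6 by rewrite ltrXn2r //; lra.
rewrite gt_eqF //; have -> : (- x ^+ 2) ^+ 3 = - x ^+ 6 by ring.
by nra.
Qed.

Unset Implicit Arguments.

(* E'_{a,b} : y^2 = x^3 - a^2 x + b^6, i.e. A = -a^2, B = b^6. *)
Theorem theorem1p3 (a b : int) :
  0 < a -> a < b ->
  ec_nonsingular (- (a%:~R) ^+ 2) ((b%:~R) ^+ 6) /\
  mw_rank_ge (- (a%:~R) ^+ 2) ((b%:~R) ^+ 6) 3.
Proof.
move=> a0 ab; have ns := nonsingular_curve a0 ab; split=> //.
have ra0 : a%:~R != 0 :> rat by rewrite intr_eq0; lia.
have rb0 : b%:~R != 0 :> rat by rewrite intr_eq0; lia.
pose pts : seq (ecgroup ns) := [:: ECGroup ns (oncurve_P a%:~R b%:~R);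
  ECGroup ns (oncurve_Q a%:~R b%:~R); ECGroup ns (oncurve_R a%:~R b%:~R)].
exists (fun i => val (nth 0 pts i)); split=> [i|c]; first exact: valP.
rewrite !big_ord_recl big_ord0 ecadd0 -!val_ecgroup_mulz -!val_ecgroupD -(val_ecgroup0 ns).
move=> /val_inj; rewrite addrA => rel.
have nt : a%:~R / b%:~R ^+ 2 \notin plocal (pdiv_prime (denq_ratio_gt1 a0 ab)) by rewrite unfold_in negbK pdiv_dvd.
(* A finite 2-torsion point has ordinate 0, so its abscissa would be a rational root of the
   cubic. *)
have no2 (S : ecgroup ns) : S *+ 2 = 0 -> S = 0.
  rewrite mulr2n => /eqP; rewrite addr_eq0 => /eqP; case: S => [[|x y] h] /(congr1 val) /=.
    by move=> _; apply: val_inj.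
  case=> ey; have y0 : y = 0 by lra.
  have /oncurveP h0 := h; rewrite y0 expr0n /= in h0.
  by case: (@cubic_no_rat_root _ _ a0 ab x); lra.
have [c0 c1 c2] := relation_trivial ra0 rb0 nt no2 rel.
case=> [[|[|[|i]]] hi] //; [rewrite -c0 | rewrite -c1 | rewrite -c2]; congr c; exact: val_inj.
Qed.
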